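(* Let $q\in(0,1/2)$ and let $H\subset\mathbb{N}$ be an infinite set whose complement $\mathbb{N}\setminus H$ is also infinite, and suppose that $1\notin H$ and $2\in H$. Then there is no absolutely summable sequence $(x_n)_{n\ge 1}$ of real numbers with $E(x_n)=N_q^H$; that is, the regular Cantorval $N_q^H$ is not an achievement set of a sequence.
   Context: $\mathbb{N}=\{1,2,3,\dots\}$. For an absolutely summable sequence $(x_n)$ of real numbers, its achievement set is $E(x_n)=\{\sum_{n=1}^\infty \varepsilon_n x_n : (\varepsilon_n)\in\{0,1\}^{\mathbb{N}}\}$. For $q\in(0,1/2)$, sets $U_n^q$ ($n\ge1$) are defined by the usual Cantor construction: start with the interval $[0,1]$; at the $n$-th step there are $2^{n-1}$ disjoint closed intervals of length $q^{n-1}$, and from each of them one removes the concentric open middle interval of length $q^{n-1}(1-2q)$, leaving $2^n$ closed intervals of length $q^n$. $U_n^q$ denotes the union of the $2^{n-1}$ open intervals removed at the $n$-th step. The geometric Cantor set is $C_q=[0,1]\setminus\bigcup_{n=1}^\infty U_n^q$. For $H\subset\mathbb{N}$ infinite with infinite complement, the regular Cantorval is $N_q^H=[0,1]\setminus\bigcup_{n\in H}U_n^q$. *)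

(* Defs.v *)
From mathcomp Require Import all_boot all_order all_algebra.
From mathcomp Require Import all_classical all_reals all_analysis.

Set Implicit Arguments.
Unset Strict Implicit.
Unset Printing Implicit Defensive.

Import Order.TTheory GRing.Theory Num.Theory.
Import numFieldNormedType.Exports.

Local Open Scope classical_set_scope.
Local Open Scope ring_scope.

(* The mathematical x_1, x_2, ... is stored as x 0, x 1, ... *)
Definition absolutely_summable (R : realType) (x : R^nat) : Prop :=
  cvgn [normed series x].

Definition achievement_set (R : realType) (x : R^nat) : set R :=
  [set y | exists eps : nat -> bool,
     [series (eps n)%:R * x n]_n @ \oo --> y].

(* A pair (a, b) stands for the interval with endpoints a and b; middle g J is
   the concentric interval of length g. *)
Definition middle (R : realType) (g : R) (J : R * R) : R * R :=
  ((J.1 + J.2 - g) / 2, (J.1 + J.2 + g) / 2).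

Definition split_middle (R : realType) (g : R) (J : R * R) : seq (R * R) :=
  [:: (J.1, (middle g J).1); ((middle g J).2, J.2)].

Fixpoint cantor_intervals (R : realType) (q : R) (n : nat) : seq (R * R) :=
  if n is m.+1 then
    flatten (map (split_middle (q ^+ m * (1 - 2 * q))) (cantor_intervals q m))
  else [:: (0, 1)].

(* Steps are numbered from 1: step n acts on the intervals left after n - 1
   steps.  The value at n = 0 is meaningless. *)
Definition cantor_removed (R : realType) (q : R) (n : nat) : set R :=
  [set t | exists2 J, J \in cantor_intervals q n.-1 &
     t \in `](middle (q ^+ n.-1 * (1 - 2 * q)) J).1,
             (middle (q ^+ n.-1 * (1 - 2 * q)) J).2[].

Definition posnat : set nat := [set n | (0 < n)%N].

Definition regular_cantorval (R : realType) (q : R) (H : set nat) : set R :=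
  `[0, 1] `\` \bigcup_(n in H) cantor_removed q n.

(* Main.v *)
(** Since N_q^H contains each x_n and lies in [0, 1], all terms are nonnegative.
    The gap (q^2, q - q^2) is longer than every gap to its left, so
    b := q - q^2 is a term, and the terms below b sum up to q^2 and achieve
    exactly T := N_q^H `&` [0, q^2].  Let w be the finite sequence of terms
    that are at least b; its sum is 1 - q^2.

    A term b + q^2 t with 0 < t < 1 shifts T into N_q^H, and comparing the
    longest gaps and intervals forces t >= 1 - q; hence a term above b is at
    least q - q^3.  The holes of T near 0 prevent q + T from covering the
    interval to the right of q, so some term lies strictly between b and q.
    Finally, [q, 1 - q] is contained in N_q^H, and below the sum p of the two
    smallest terms of w it can only be covered by the translates z + T for
    single terms z, of diameter q^2.  This needs so many large terms that
    their sum exceeds 1 - q^2, except for w = (b, b, (1 - q)^2), where the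
    holes of T to the right of q^2 - q^3 leave a point uncovered. *)

Require Import Defs.
From mathcomp Require Import all_boot all_order all_algebra.
From mathcomp Require Import all_classical all_reals all_analysis.
From mathcomp Require Import ring lra zify.

Set Implicit Arguments.
Unset Strict Implicit.

Import Order.TTheory GRing.Theory Num.Theory.
Import numFieldNormedType.Exports.

Local Open Scope classical_set_scope.
Local Open Scope ring_scope.

(** * Self-similarity of the Cantorvals, their holes and intervals *)

(** Inside each of the two intervals of length q left by step 1, step n + 1 acts as step n of a
    rescaled construction. The guard [0 < n] drops step 1 itself. *)
Definition shift_steps (H : set nat) : set nat := [set n | (0 < n)%N /\ H n.+1].

Lemma infinite_nat_unbounded (H : set nat) (n : nat) :
  infinite_set H -> exists2 m, (n < m)%N & H m.
Proof.
move=> H_inf; apply: contrapT => nex; apply: H_inf.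
apply: (sub_finite_set _ (finite_II n.+1)) => m Hm /=.
by rewrite ltnS leqNgt; apply/negP => nm; apply: nex; exists m.
Qed.

Lemma shift_steps_infinite (H : set nat) :
  infinite_set H -> infinite_set (shift_steps H).
Proof.
move=> H_inf fin; apply: H_inf.
have sub : H `<=` [set` [:: 0; 1]%N] `|` (S @` shift_steps H).
  by move=> [|[|n]] Hn; [left; rewrite /= inE..|right; exists n.+1].
apply: sub_finite_set sub _; rewrite finite_setU; split; first exact: finite_seq.
exact: finite_image.
Qed.

Section Cantorval.
Variables (R : realType) (q : R).
Hypotheses (q_gt0 : 0 < q) (q_lt : q < 1 / 2).

Let affine (c : R) (J : R * R) : R * R := (c + q * J.1, c + q * J.2).

Lemma split_middle_affine (g c : R) (J : R * R) :
  split_middle (q * g) (affine c J) = map (affine c) (split_middle g J).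
Proof. by rewrite /split_middle /middle /affine /=; congr [:: (_, _); (_, _)];
  field. Qed.

(** The definition subdivides the last generation; self-similarity needs the recursion at the first
    step instead. *)
Lemma cantor_intervals_recl (n : nat) :
  cantor_intervals q n.+1 =
    map (affine 0) (cantor_intervals q n) ++
    map (affine (1 - q)) (cantor_intervals q n).
Proof.
elim: n => [|n IHn].
  rewrite /= /split_middle /middle /affine /= expr0.
  by congr [:: (_, _); (_, _)]; field.
rewrite -[LHS]/(flatten (map (split_middle (q ^+ n.+1 * (1 - 2 * q)))
  (cantor_intervals q n.+1))) {1}IHn map_cat flatten_cat.
have E c : flatten (map (split_middle (q ^+ n.+1 * (1 - 2 * q)))
    (map (affine c) (cantor_intervals q n))) =
    map (affine c) (cantor_intervals q n.+1).
  rewrite /= map_flatten -!map_comp; congr flatten; apply: eq_map => J /=.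
  by rewrite exprS -mulrA split_middle_affine.
by rewrite !E.
Qed.

Lemma cantor_removed1 (t : R) : cantor_removed q 1 t <-> q < t < 1 - q.
Proof.
rewrite /cantor_removed /= /middle; split.
  case=> J; rewrite inE => /eqP ->; rewrite in_itv /= => /andP[t1 t2].
  by apply/andP; split; lra.
move=> /andP[t1 t2]; exists (0, 1); first by rewrite inE.
by rewrite in_itv /=; apply/andP; split; lra.
Qed.

Lemma cantor_removedSS (n : nat) (t : R) :
  cantor_removed q n.+2 t <->
  exists2 v, cantor_removed q n.+1 v & t = q * v \/ t = 1 - q + q * v.
Proof.
have midE c J v : (c + q * v \in `](middle (q ^+ n.+1 * (1 - 2 * q)) (affine c J)).1,
    (middle (q ^+ n.+1 * (1 - 2 * q)) (affine c J)).2[) =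
    (v \in `](middle (q ^+ n * (1 - 2 * q)) J).1, (middle (q ^+ n * (1 - 2 * q)) J).2[).
  have ltE u w : (u < w) = (c + q * u < c + q * w) by rewrite ltrD2l ltr_pM2l.
  rewrite !in_itv [in RHS]/= !(ltE _ v) !(ltE v) /middle /affine /= exprS.
  by congr (_ && _); congr (_ < _); field.
rewrite /cantor_removed; split.
  case=> J; rewrite /= -[flatten _]/(cantor_intervals q n.+1) cantor_intervals_recl mem_cat.
  set v := fun c => (t - c) / q.
  have tE c : t = c + q * v c by rewrite /v; field; rewrite gt_eqF.
  case/orP=> /mapP[J0 J0in ->].
    rewrite {1}(tE 0) midE => h; exists (v 0); first by exists J0.
    by left; rewrite {1}(tE 0) add0r.
  rewrite {1}(tE (1 - q)) midE => h; exists (v (1 - q)); first by exists J0.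
  by right.
case=> v [J Jin vJ] [] ->.
  exists (affine 0 J).
    by rewrite [_.-1]/= cantor_intervals_recl mem_cat; apply/orP; left; apply: map_f.
  by rewrite -[q * v]add0r midE.
exists (affine (1 - q) J).
  by rewrite [_.-1]/= cantor_intervals_recl mem_cat; apply/orP; right; apply: map_f.
by rewrite midE.
Qed.

Lemma scale_bounds (v : R) : 0 <= v <= 1 -> 0 <= q * v <= q.
Proof. by move=> /andP[v0 v1]; rewrite mulr_ge0 ?(ltW q_gt0)//= ler_piMr// ltW. Qed.

Lemma scale_bounds_lt (v : R) : 0 < v < 1 -> 0 < q * v < q.
Proof. by move=> /andP[v0 v1]; rewrite mulr_gt0//= gtr_pMr. Qed.

Lemma cantor_removed_bounds (n : nat) (t : R) :
  cantor_removed q n.+1 t -> 0 < t < 1.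
Proof.
have [q0 q2] := (q_gt0, q_lt).
elim: n t => [|n IHn] t.
  by move=> /cantor_removed1 /andP[? ?]; apply/andP; split; lra.
move=> /cantor_removedSS[v /IHn/scale_bounds_lt/andP[v0 v1]] [] ->.
  by apply/andP; split; lra.
by apply/andP; split; lra.
Qed.

Local Notation N := (regular_cantorval q).

Lemma cantorval_bounds (H : set nat) (t : R) : N H t -> 0 <= t <= 1.
Proof. by case; rewrite /= in_itv. Qed.

Lemma cantorval0 (H : set nat) : H `<=` posnat -> N H 0.
Proof.
move=> H_pos; split; first by rewrite /= in_itv /= lexx ler01.
case=> -[|n] /[dup] /H_pos; rewrite /posnat //= => _ _.
by move=> /cantor_removed_bounds; rewrite ltxx.
Qed.

Lemma cantorval1 (H : set nat) : H `<=` posnat -> N H 1.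
Proof.
move=> H_pos; split; first by rewrite /= in_itv /= lexx ler01.
case=> -[|n] /[dup] /H_pos; rewrite /posnat //= => _ _.
by move=> /cantor_removed_bounds; rewrite ltxx andbF.
Qed.

Lemma shift_steps_pos (H : set nat) : shift_steps H `<=` posnat.
Proof. by move=> n []. Qed.

(** True whether or not H contains 1: step 1 removes nothing from [0, q], and later removals in the
    right copy stay above 1 - q. *)
Lemma cantorval_left (H : set nat) (t : R) : H `<=` posnat -> 0 <= t <= 1 ->
  N H (q * t) <-> N (shift_steps H) t.
Proof.
have [q0 q2] := (q_gt0, q_lt).
move=> H_pos t01; have /andP[t0 t1] := scale_bounds t01.
split=> -[_ Nt]; (split; first by rewrite /= in_itv /= ?t01//; apply/andP;
  split; lra).
  case=> -[|n] [] //= _ Hn tn; apply: Nt; exists n.+2 => //.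
  by apply/cantor_removedSS; exists t => //; left.
case=> -[|[|n]] Hn; first by have := H_pos _ Hn; rewrite /posnat.
  by move=> /cantor_removed1/andP[]; lra.
move=> /cantor_removedSS[v vn] [] tE.
  have {}tE : t = v by apply: (mulfI (lt0r_neq0 q_gt0)).
  by apply: Nt; exists n.+1 => //; rewrite tE.
by have /andP[v0 v1] := scale_bounds_lt (cantor_removed_bounds vn); lra.
Qed.

Lemma cantorval_right (H : set nat) (t : R) : H `<=` posnat -> 0 <= t <= 1 ->
  N H (1 - q + q * t) <-> N (shift_steps H) t.
Proof.
have [q0 q2] := (q_gt0, q_lt).
move=> H_pos t01; have /andP[t0 t1] := scale_bounds t01.
split=> -[_ Nt]; (split; first by rewrite /= in_itv /= ?t01//; apply/andP;
  split; lra).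
  case=> -[|n] [] //= _ Hn tn; apply: Nt; exists n.+2 => //.
  by apply/cantor_removedSS; exists t => //; right.
case=> -[|[|n]] Hn; first by have := H_pos _ Hn; rewrite /posnat.
  by move=> /cantor_removed1/andP[]; lra.
move=> /cantor_removedSS[v vn] [] tE.
  by have /andP[v0 v1] := scale_bounds_lt (cantor_removed_bounds vn); lra.
have {}tE : t = v by apply: (mulfI (lt0r_neq0 q_gt0)); lra.
by apply: Nt; exists n.+1 => //; rewrite tE.
Qed.

Lemma cantorval_mid (H : set nat) (t : R) : H `<=` posnat -> q < t < 1 - q ->
  N H t <-> ~ H 1%N.
Proof.
have [q0 q2] := (q_gt0, q_lt).
move=> H_pos tq; have /andP[t1 t2] := tq; split=> [[_ Nt] H1|H1].
  by apply: Nt; exists 1%N => //; apply/cantor_removed1.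
split; first by rewrite /= in_itv /=; apply/andP; split; lra.
case=> -[|[|n]] Hn //; first by have := H_pos _ Hn; rewrite /posnat.
move=> /cantor_removedSS[v /cantor_removed_bounds/scale_bounds_lt/andP[v0 v1]] [] tE; lra.
Qed.

End Cantorval.

(** * Lengths of gaps and intervals of a Cantorval *)

Section Gaps.
Variables (R : realType) (q : R).
Hypotheses (q_gt0 : 0 < q) (q_lt : q < 1 / 2).

Local Notation N := (regular_cantorval q).

Lemma cantorval_q (H : set nat) : H `<=` posnat -> N H q.
Proof.
move=> H_pos; rewrite -[q in N H q]mulr1; apply/cantorval_left => //.
  by rewrite ler01 lexx.
exact/cantorval1/shift_steps_pos.
Qed.

Lemma cantorval_1Bq (H : set nat) : H `<=` posnat -> N H (1 - q).
Proof.
move=> H_pos; rewrite -[1 - q]addr0 -[X in _ + X](mulr0 q).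
apply/cantorval_right => //; first by rewrite ler01 lexx.
exact/cantorval0/shift_steps_pos.
Qed.

Lemma cantorval_left_div (H : set nat) (s : R) : H `<=` posnat -> 0 <= s <= q ->
  N H s <-> N (shift_steps H) (s / q).
Proof.
move=> H_pos /andP[s0 sq]; rewrite -cantorval_left //.
  by rewrite mulrC divfK // gt_eqF.
by rewrite divr_ge0 ?(ltW q_gt0) //= ler_pdivrMr // mul1r.
Qed.

Lemma cantorval_right_div (H : set nat) (s : R) : H `<=` posnat ->
  1 - q <= s <= 1 -> N H s <-> N (shift_steps H) ((s - (1 - q)) / q).
Proof.
move=> H_pos /andP[s0 sq]; rewrite -cantorval_right //.
  by rewrite (mulrC q) divfK ?gt_eqF // addrC subrK.
rewrite divr_ge0 ?(ltW q_gt0) //= ?subr_ge0 // ler_pdivrMr // mul1r.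
by lra.
Qed.

(** Step n + 1 removes the centres of the leftmost and the rightmost interval of length q^n. *)
Lemma cantorval_hole (n : nat) (H : set nat) : H `<=` posnat -> H n.+1 ->
  ~ N H (q ^+ n / 2) /\ ~ N H (1 - q ^+ n / 2).
Proof.
have [q0 q2] := (q_gt0, q_lt).
elim: n H => [|n IHn] H H_pos Hn.
  rewrite expr0; have -> : 1 - 1 / 2 = 1 / 2 :> R by lra.
  suff : ~ N H (1 / 2) by [].
  by move=> /cantorval_mid -/(_ q_gt0 q_lt H_pos) []//; apply/andP; split; lra.
have /andP[x0 x1] : 0 <= q ^+ n / 2 <= 1.
  have : 0 <= q ^+ n by rewrite exprn_ge0 // ltW.
  have : q ^+ n <= 1 by rewrite exprn_ile1 ?ltW //; lra.
  by move=> ? ?; apply/andP; split; lra.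
have [] := IHn (shift_steps H) (@shift_steps_pos H) (conj isT Hn).
rewrite -cantorval_left ?x0 // -cantorval_right //; last by apply/andP; split; lra.
have -> : q ^+ n.+1 / 2 = q * (q ^+ n / 2) by rewrite exprS mulrA.
by have -> : 1 - q + q * (1 - q ^+ n / 2) = 1 - q * (q ^+ n / 2) by ring.
Qed.

Lemma small_power (e : R) : 0 < e -> exists n, forall m, (n <= m)%N -> q ^+ m < e.
Proof.
move=> e_gt0; have [q0 q2] := (q_gt0, q_lt).
(* As q < 1/2, it suffices that 2^m exceeds 1/e. *)
exists (Num.bound e^-1) => m /upper_nthrootP e2.
have qm : q ^+ m <= (2 ^+ m)^-1.
  rewrite -exprVn; apply: lerXn2r; rewrite ?nnegrE ?(ltW q_gt0) ?invr_ge0 //.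
  by lra.
apply: le_lt_trans qm _.
by rewrite -[e]invrK ltf_pV2 // posrE ?invr_gt0 // exprn_gt0.
Qed.

Lemma cantorval_hole_near (H : set nat) (e : R) : H `<=` posnat ->
  infinite_set H -> 0 < e ->
  exists2 d, 0 < d < e & [/\ d < 1, ~ N H d & ~ N H (1 - d)].
Proof.
move=> H_pos H_inf e_gt0; have [q0 q2] := (q_gt0, q_lt).
have [n qn] := small_power e_gt0.
have [[|m] nm Hm] := infinite_nat_unbounded n H_inf; first by [].
have [h0 h1] := cantorval_hole H_pos Hm; have qme := qn m nm.
have qm0 : 0 < q ^+ m by rewrite exprn_gt0.
have qm1 : q ^+ m <= 1 by rewrite exprn_ile1 ?ltW //; lra.
exists (q ^+ m / 2); first by apply/andP; split; lra.
by split=> //; lra.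
Qed.

Lemma hole_left_q (H : set nat) (a : R) : H `<=` posnat ->
  infinite_set H -> a < q -> exists2 s, a < s < q & ~ N H s.
Proof.
move=> H_pos H_inf aq.
have e0 : 0 < (q - a) / q by rewrite divr_gt0 // subr_gt0.
have [d /andP[d0]] :=
  cantorval_hole_near (@shift_steps_pos H) (shift_steps_infinite H_inf) e0.
rewrite ltr_pdivlMr // => dq [d1 _]; rewrite -cantorval_left //;
  last by apply/andP; split; lra.
move=> h; exists (q * (1 - d)) => //.
have qd : 0 < q * d by rewrite mulr_gt0.
by apply/andP; split; lra.
Qed.

Lemma hole_right_1Bq (H : set nat) (b : R) : H `<=` posnat ->
  infinite_set H -> 1 - q < b -> exists2 s, 1 - q < s < b & ~ N H s.
Proof.
move=> H_pos H_inf qb.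
have e0 : 0 < (b - (1 - q)) / q by rewrite divr_gt0 // subr_gt0.
have [d /andP[d0]] :=
  cantorval_hole_near (@shift_steps_pos H) (shift_steps_infinite H_inf) e0.
rewrite ltr_pdivlMr // => dq [d1 + _]; rewrite -cantorval_right //;
  last by apply/andP; split; lra.
move=> h; exists (1 - q + q * d) => //.
have qd : 0 < q * d by rewrite mulr_gt0.
by apply/andP; split; lra.
Qed.

(* Blowing up a piece longer than 1 - 2q multiplies its length by 1/q, and the
   result is again longer than 1 - 2q, while all pieces live in [0, 1]. *)
Lemma length_bound (Q : set nat -> R -> R -> Prop) :
  (forall H a b, Q H a b -> 0 <= a /\ b <= 1) ->
  (forall H a b, H `<=` posnat -> infinite_set H -> Q H a b ->
    1 - 2 * q < b - a ->
    exists a' b', Q (shift_steps H) a' b' /\ b - a = q * (b' - a')) ->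
  forall H a b, H `<=` posnat -> infinite_set H -> Q H a b ->
    b - a <= 1 - 2 * q.
Proof.
move=> Q01 Qshift H a b H_pos H_inf Qab; have [q0 q2] := (q_gt0, q_lt).
rewrite leNgt; apply/negP => long.
have [|n /(_ n (leqnn n))] := @small_power (1 - 2 * q); first by lra.
suff : b - a <= q ^+ n by lra.
elim: n H a b H_pos H_inf Qab long => [|n IHn] H a b H_pos H_inf Qab long.
  by have [] := Q01 _ _ _ Qab; rewrite expr0; lra.
have [a' [b' [Qab' abE]]] := Qshift _ _ _ H_pos H_inf Qab long.
rewrite exprS abE ler_pM2l //.
apply: IHn Qab' _; [exact: shift_steps_pos|exact: shift_steps_infinite|].
rewrite -(ltr_pM2l q_gt0) -abE; apply: lt_trans long.
by rewrite gtr_pMl; lra.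
Qed.

(** An interval longer than 1 - 2q overhangs [q, 1 - q], and holes accumulate at q from the left and
    at 1 - q from the right. So it lies in one of the two copies, and [length_bound] applies. *)
Lemma interval_length (H : set nat) (a b : R) : H `<=` posnat ->
  infinite_set H -> (forall s, a <= s <= b -> N H s) ->
  b - a <= 1 - 2 * q.
Proof.
move=> H_pos H_inf abN; have [q0 q2] := (q_gt0, q_lt).
have [|ab] := ltP b a; first by lra.
pose Q H (a b : R) := [/\ 0 <= a, b <= 1 & forall s, a <= s <= b -> N H s].
apply: (@length_bound Q _ _ H) => //.
- by move=> ? ? ? [].
- move=> {H a b H_pos H_inf abN ab} H a b H_pos H_inf [a0 b1 abN] long.
  have inq s : a <= s <= b -> N H s := abN s.
  have [bq|qb] := ltP b q.
    exists (a / q), (b / q); split; last by field; rewrite gt_eqF.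
    split; first by rewrite divr_ge0 // ltW.
      by rewrite ler_pdivrMr // mul1r ltW.
    move=> s /andP[]; rewrite ler_pdivrMr // ler_pdivlMr // => sa sb.
    have sE : s = (s * q) / q by field; rewrite gt_eqF.
    rewrite sE -cantorval_left_div //; first by apply: abN; rewrite sa sb.
    by apply/andP; split; lra.
  have [aq|qa] := ltP a q.
    have [s /andP[s1 s2] []] := hole_left_q H_pos H_inf aq.
    by apply: abN; apply/andP; split; lra.
  have [aq|qa'] := leP a (1 - q).
    have [bq|qb'] := leP b (1 - q); first by lra.
    have [s /andP[s1 s2] []] := hole_right_1Bq H_pos H_inf qb'.
    by apply: abN; apply/andP; split; lra.
  exists ((a - (1 - q)) / q), ((b - (1 - q)) / q); split; last by field;
    rewrite gt_eqF.
  split; first by rewrite divr_ge0 ?subr_ge0 // ltW.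
    by rewrite ler_pdivrMr // mul1r; lra.
  move=> s /andP[]; rewrite ler_pdivrMr // ler_pdivlMr // => sa sb.
  have sE : s = (1 - q + s * q - (1 - q)) / q by field; rewrite gt_eqF.
  rewrite sE -cantorval_right_div //; first by apply: abN; apply/andP; split; lra.
  by apply/andP; split; lra.
- split=> //.
    by have := abN a; rewrite lexx ab => /(_ isT)/cantorval_bounds/andP[].
  by have := abN b; rewrite lexx ab => /(_ isT)/cantorval_bounds/andP[].
Qed.

(** The points q and 1 - q always belong to the Cantorval, so a gap longer than 1 - 2q lies in one
    of the two copies. *)
Lemma gap_length (H : set nat) (a b : R) : H `<=` posnat ->
  infinite_set H -> 0 <= a -> b <= 1 -> (forall s, a < s < b -> ~ N H s) ->
  b - a <= 1 - 2 * q.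
Proof.
move=> H_pos H_inf a0 b1 abN; have [q0 q2] := (q_gt0, q_lt).
pose Q H (a b : R) := [/\ 0 <= a, b <= 1 & forall s, a < s < b -> ~ N H s].
apply: (@length_bound Q _ _ H) => //.
- by move=> ? ? ? [].
- move=> {H a b H_pos H_inf abN a0 b1} H a b H_pos H_inf [a0 b1 abN] long.
  have [bq|qb] := leP b q.
    exists (a / q), (b / q); split; last by field; rewrite gt_eqF.
    split; first by rewrite divr_ge0 // ltW.
      by rewrite ler_pdivrMr // mul1r.
    move=> s /andP[]; rewrite ltr_pdivrMr // ltr_pdivlMr // => sa sb.
    have sE : s = (s * q) / q by field; rewrite gt_eqF.
    rewrite sE -cantorval_left_div //; first by apply: abN; rewrite sa sb.
    by apply/andP; split; lra.
  have [aq|qa] := ltP a q.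
    by have [] := abN q; [rewrite aq qb|exact: cantorval_q].
  have [aq|qa'] := ltP a (1 - q).
    have [bq|qb'] := leP b (1 - q); first by lra.
    by have [] := abN (1 - q); [rewrite aq qb'|exact: cantorval_1Bq].
  exists ((a - (1 - q)) / q), ((b - (1 - q)) / q); split; last by field;
    rewrite gt_eqF.
  split; first by rewrite divr_ge0 ?subr_ge0 // ltW.
    by rewrite ler_pdivrMr // mul1r; lra.
  move=> s /andP[]; rewrite ltr_pdivrMr // ltr_pdivlMr // => sa sb.
  have sE : s = (1 - q + s * q - (1 - q)) / q by field; rewrite gt_eqF.
  rewrite sE -cantorval_right_div //; first by apply: abN; apply/andP; split; lra.
  by apply/andP; split; lra.
Qed.

(* A small shift would move the middle interval, which is either the longest gap
   of N_q^H or its longest component, into a copy of ratio q, where it does not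
   fit. *)
Lemma translation_large (H : set nat) (t : R) : H `<=` posnat ->
  infinite_set H -> 0 < t < 1 ->
  (forall v, N H v -> v + t <= 1 -> N H (v + t)) -> 1 - q <= t.
Proof.
move=> H_pos H_inf /andP[t0 t1] Ht; have [q0 q2] := (q_gt0, q_lt).
rewrite leNgt; apply/negP => tq.
have len0 : 1 - 2 * q < (1 - 2 * q) / q.
  by rewrite ltr_pdivlMr // gtr_pMr; lra.
have [sH_pos sH_inf] := (@shift_steps_pos H, shift_steps_infinite H_inf).
have [H1|H1] := pselect (H 1%N).
  have mid v : q < v < 1 - q -> ~ N H v by move=> vq /(cantorval_mid q_gt0 q_lt H_pos vq).
  have : N H t by rewrite -[t]add0r; apply: Ht; [exact: cantorval0|lra].
  have [tq' _|qt] := leP t q; last by apply: mid; rewrite qt tq.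
  (* The middle gap moved left by t is again a gap. It cannot contain q, so it lies in the left
     copy, where it is too long. *)
  have gap v : q - t < v < 1 - q - t -> ~ N H v.
    move=> /andP[v1 v2] Nv; apply: (@mid (v + t)); first by apply/andP; split; lra.
    by apply: Ht => //; lra.
  have [lt1|ge1] := ltP q (1 - q - t).
    by apply: (gap q); [apply/andP; split; lra|exact: cantorval_q].
  have : (1 - q - t) / q - (q - t) / q <= 1 - 2 * q.
    apply: (gap_length sH_pos sH_inf).
    - by rewrite divr_ge0 // ?subr_ge0 // ltW.
    - by rewrite ler_pdivrMr // mul1r.
    move=> s /andP[]; rewrite ltr_pdivrMr // ltr_pdivlMr // => sa sb.
    have sE : s = (s * q) / q by field; rewrite gt_eqF.
    rewrite sE -cantorval_left_div //; first by apply: gap; rewrite sa sb.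
    by apply/andP; split; lra.
  have -> : (1 - q - t) / q - (q - t) / q = (1 - 2 * q) / q by field; rewrite gt_eqF.
  by lra.
have mid v : q <= v <= 1 - q -> N H v.
  rewrite le_eqVlt => /andP[/predU1P[<- _|qv]]; first exact: cantorval_q.
  rewrite le_eqVlt => /predU1P[->|vq]; first exact: cantorval_1Bq.
  by apply/cantorval_mid => //; rewrite qv vq.
(* For t >= q the shifted middle interval would cover a left neighbourhood of 1, where holes
   accumulate. *)
have [qt|tq'] := leP q t.
  have [|d /andP[d0 d1] [_ _]] := @cantorval_hole_near H (1 - q - t) H_pos H_inf; first by lra.
  apply; have -> : 1 - d = 1 - d - t + t by ring.
  by apply: Ht; [apply: mid; apply/andP; split|]; lra.
have mid' v : q + t <= v <= 1 - q + t -> N H v.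
  move=> /andP[v1 v2]; rewrite -[v](subrK t).
  by apply: Ht; [apply: mid; apply/andP; split|]; lra.
(* Either the middle interval and its shift meet and merge into an interval longer than 1 - 2q, or
   the shift lies in the right copy, where it is too long. *)
have [le1|lt1] := leP (q + t) (1 - q).
  have : 1 - q + t - q <= 1 - 2 * q; last by lra.
  apply: (interval_length H_pos H_inf) => s /andP[s1 s2].
  by have [s3|s3] := leP s (1 - q); [apply: mid|apply: mid']; apply/andP; split; lra.
have : (1 - q + t - (1 - q)) / q - (q + t - (1 - q)) / q <= 1 - 2 * q.
  apply: (interval_length sH_pos sH_inf).
  move=> s /andP[]; rewrite ler_pdivrMr // ler_pdivlMr // => sa sb.
  have sE : s = (1 - q + s * q - (1 - q)) / q by field; rewrite gt_eqF.
  rewrite sE -cantorval_right_div //; first by apply: mid'; apply/andP; split; lra.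
  by apply/andP; split; lra.
have -> : (1 - q + t - (1 - q)) / q - (q + t - (1 - q)) / q = (1 - 2 * q) / q.
  by field; rewrite gt_eqF.
by lra.
Qed.

End Gaps.

(** * Achievement sets with a dominating gap *)

Lemma achievement_term (R : realType) (x : R^nat) (i : nat) :
  [series (pred1 i n)%:R * x n]_n @ \oo --> x i.
Proof.
apply: cvg_near_cst; exists i.+1 => // n /= lin.
rewrite /series /= (eq_bigr (fun k => if k == i then x k else 0)).
  by rewrite -big_mkcond big_nat1_eq /= lin.
by move=> k _; case: eqP; rewrite ?mul1r ?mul0r.
Qed.

Section Subsums.
Variables (R : realType) (x : R^nat).
Hypotheses (x_ge0 : forall n, 0 <= x n) (x_sum : absolutely_summable x).

Definition subsum (e : pred nat) : R := limn [series (e n)%:R * x n]_n.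

Lemma subsum_cvg (e : pred nat) :
  [series (e n)%:R * x n]_n @ \oo --> subsum e.
Proof.
apply: (@series_le_cvg _ _ (fun n => `|x n|)) => // n /=; first by rewrite mulr_ge0.
by rewrite ger0_norm //; case: (e n); rewrite ?mul1r ?mul0r.
Qed.

Lemma achievement_setP (y : R) :
  achievement_set x y <-> exists e : pred nat, y = subsum e.
Proof.
split=> [[e ye]|[e ->]]; exists e; last exact: subsum_cvg.
by apply/esym/cvg_lim.
Qed.

Lemma subsum_ach (e : pred nat) : achievement_set x (subsum e).
Proof. by apply/achievement_setP; exists e. Qed.

Lemma subsumU (e f : pred nat) : (forall n, e n -> ~~ f n) ->
  subsum (fun n => e n || f n) = subsum e + subsum f.
Proof.
move=> ef; rewrite -lim_seriesD; [|exact: subsum_cvg..].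
congr (limn (series _)); apply/funext => n.
rewrite /GRing.add /= /GRing.add_fun -mulrDl; congr (_ * _).
by case: (e n) (ef n) => [/(_ isT)/negPf ->|_]; rewrite ?addr0 ?add0r.
Qed.

Lemma le_subsum (e f : pred nat) : (forall n, e n -> f n) ->
  subsum e <= subsum f.
Proof.
move=> ef; apply: lim_series_le; [exact: subsum_cvg..|move=> n /=].
by apply: ler_wpM2r => //; case: (e n) (ef n) => // /(_ isT) ->.
Qed.

Lemma subsum1 (i : nat) : subsum (pred1 i) = x i.
Proof. exact/cvg_lim/achievement_term. Qed.

Lemma subsum0 : subsum xpred0 = 0.
Proof.
apply/cvg_lim => //; apply: cvg_near_cst; near=> n.
by rewrite /series /= big1 // => k _; rewrite mul0r.
Unshelve. all: by end_near. Qed.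

Lemma subsum_seq (s : seq nat) : uniq s ->
  subsum (fun i => i \in s) = \sum_(i <- s) x i.
Proof.
elim: s => [_|i s IHs /= /andP[i_s s_uniq]].
  rewrite big_nil -subsum0; congr subsum; exact/funext.
rewrite big_cons -IHs // -subsum1 -subsumU; last by move=> n /= /eqP ->.
by congr subsum; apply/funext => n; rewrite inE.
Qed.

Lemma subsum_ge (e : pred nat) (i : nat) : e i -> x i <= subsum e.
Proof. by move=> ei; rewrite -subsum1; apply: le_subsum => n /= /eqP ->. Qed.

Lemma subsum_le_finite (e : pred nat) (a : R) :
  (forall s, uniq s -> all e s -> \sum_(i <- s) x i <= a) -> subsum e <= a.
Proof.
move=> sa; apply: limr_le; first exact: subsum_cvg.
near=> n; rewrite /series /= (eq_bigr (fun k => if e k then x k else 0)); last first.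
  by move=> k _; case: (e k); rewrite ?mul1r ?mul0r.
rewrite -big_mkcond -big_filter; apply: sa; first by rewrite filter_uniq ?iota_uniq.
exact: filter_all.
Unshelve. all: by end_near. Qed.

Section FirstGap.
Variables (a c : R).
Hypothesis (ac : a < c).
Hypothesis a_ge0 : 0 <= a.
Hypothesis no_ach : forall t, achievement_set x t -> ~ (a < t < c).
(** This makes (a, c) longer than every gap of the achievement set to its left. *)
Hypothesis dense_below : forall u, 0 <= u -> u + (c - a) <= a ->
  exists2 t, achievement_set x t & u < t < u + (c - a).

Lemma ach_gap (t : R) : achievement_set x t -> t < c -> t <= a.
Proof.
move=> tx tc; rewrite leNgt; apply/negP => ta.
by apply: (no_ach tx); rewrite ta tc.
Qed.

Lemma term_gap (i : nat) : x i < c -> x i <= a.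
Proof. by apply: ach_gap; rewrite -subsum1; exact: subsum_ach. Qed.

(* Otherwise replace the smallest term x_j of a minimal overshooting sum by an
   achieved t < x_j: such a t only involves terms not yet used, and t can be
   chosen so that the new sum lies in the gap. *)
Lemma small_terms_finite (s : seq nat) : uniq s -> all (fun i => x i < c) s ->
  \sum_(i <- s) x i <= a.
Proof.
move=> s_uniq s_small.
pose le := fun i j => x i <= x j.
have le_total : total le by move=> i j; exact: le_total.
have le_trans : transitive le by move=> j i k; exact: le_trans.
suff H s' : sorted le s' -> uniq s' -> all (fun i => x i < c) s' ->
    \sum_(i <- s') x i <= a.
  have := H (sort le s); rewrite sort_sorted // sort_uniq all_sort.
  by rewrite (perm_big s) ?perm_sort //; exact.
elim: s' {s s_uniq s_small} => [|j s IHs] => [_ _ _|].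
  by rewrite big_nil; exact: a_ge0.
move=> /= js /andP[j_s s_uniq] /andP[xj s_small].
have {}IHs : \sum_(i <- s) x i <= a by apply: IHs => //; exact: path_sorted js.
have minj i : i \in s -> x j <= x i.
  by move: js; rewrite path_sortedE // => /andP[/allP + _] => h; exact: h.
rewrite big_cons; set S := \sum_(i <- s) x i in IHs *.
apply: ach_gap.
  have <- : \sum_(i <- j :: s) x i = x j + S by rewrite big_cons.
  by rewrite -subsum_seq /= ?j_s //; exact: subsum_ach.
rewrite ltNge; apply/negP => cS.
have xja := term_gap xj.
(* The window (a - S, c - S) lies in [0, a], since c - S <= [x j] <= a. *)
have [||t + /andP[t1 t2]] := dense_below (u := a - S); [lra|lra|].
move=> /achievement_setP[e tE].
have disj i : i \in s -> ~~ e i.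
  move=> i_s; apply/negP => ei; have := subsum_ge ei; have := minj i i_s.
  by rewrite -tE; lra.
apply: (@no_ach (S + t)); last by apply/andP; split; lra.
rewrite tE /S -subsum_seq // -subsumU //; exact: subsum_ach.
Qed.

Lemma small_terms_le : subsum (fun i => x i < c) <= a.
Proof. by apply: subsum_le_finite => s; exact: small_terms_finite. Qed.

(** The list w holds the finitely many terms that are at least c. The other terms sum up to at most
    a, and to exactly a because a sum achieving a uses only them. A sum achieving c needs a term
    from w, as a < c, and that term can only be c. *)
Lemma gap_decomposition : achievement_set x a -> achievement_set x c ->
  exists w : seq R, [/\ sorted <=%R w, c \in w, all (>= c) w,
    \sum_(z <- w) z + a = subsum predT &
    (forall z t, z \in w -> achievement_set x t -> t <= a ->
       achievement_set x (z + t)) /\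
    (forall y, achievement_set x y -> exists2 s, subseq s w &
       exists2 t, achievement_set x t & t <= a /\ y = \sum_(z <- s) z + t)].
Proof.
move=> /achievement_setP[ea aE] /achievement_setP[ec cE].
have [n0 n0_small] : exists n0, forall i, (n0 <= i)%N -> x i < c.
  have x0 : x @ \oo --> 0.
    apply: cvg_series_cvg_0; apply: normed_cvg; exact: x_sum.
  have c_gt0 : 0 < c by exact: le_lt_trans a_ge0 ac.
  have /cvgr_lt /(_ _ c_gt0)[n _ xn] := x0.
  by exists n => i ni; exact: xn.
pose le := fun i j => x i <= x j.
have le_total : total le by move=> i j; exact: le_total.
pose big := sort le [seq i <- iota 0 n0 | c <= x i].
have big_uniq : uniq big by rewrite sort_uniq filter_uniq ?iota_uniq.
have mem_big i : (i \in big) = (c <= x i).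
  rewrite mem_sort mem_filter mem_iota add0n; case: leP => //= cx.
  by rewrite ltnNge; apply/negP => /n0_small; rewrite ltNge cx.
have split_big e : subsum e = \sum_(i <- [seq i <- big | e i]) x i +
    subsum (fun i => e i && (x i < c)).
  rewrite -subsum_seq ?filter_uniq // -subsumU => [|i].
    congr subsum; apply/funext => i; rewrite mem_filter mem_big.
    by case: (e i) => //=; case: leP.
  by rewrite mem_filter mem_big => /andP[-> ?]; rewrite /= -leNgt.
have small_le e : subsum (fun i => e i && (x i < c)) <= a.
  by apply: le_trans small_terms_le; apply: le_subsum => i /andP[].
exists (map x big); split.
- by rewrite sorted_map sort_sorted.
- have [i i_big eci] : exists2 i, i \in big & ec i.
    apply/hasP; apply/negPn/negP => /hasPn none.
    suff : c <= a by rewrite leNgt ac.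
    rewrite cE split_big (_ : [seq _ <- _ | _] = [::]) ?big_nil ?add0r //.
    by apply/eqP; rewrite -(negbK (_ == _)) -has_filter; apply/hasPn.
  apply/mapP; exists i => //; apply/eqP; rewrite eq_le -mem_big i_big.
  by rewrite cE subsum_ge.
- by apply/allP => _ /mapP[i + ->]; rewrite mem_big.
- rewrite split_big big_map filter_predT; congr (_ + _); apply/eqP.
  rewrite eq_le small_le andbT aE; apply: le_subsum => i eai /=.
  apply: le_lt_trans ac; rewrite aE; exact: subsum_ge.
(* A sum t <= a uses no big term, so z is still free to be added. *)
split=> [_ t /mapP[i + ->] /achievement_setP[e ->] ta|y /achievement_setP[e ->]].
  rewrite mem_big => cx; rewrite -subsum1 -subsumU; first exact: subsum_ach.
  move=> _ /eqP ->; apply/negP => /subsum_ge; rewrite leNgt => /negP; apply.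
  by apply: le_lt_trans ta _; exact: lt_le_trans ac cx.
exists (map x [seq i <- big | e i]); first exact/map_subseq/filter_subseq.
exists (subsum (fun i => e i && (x i < c))); first exact: subsum_ach.
by rewrite big_map -split_big.
Qed.

End FirstGap.
End Subsums.

(** * Counting the large terms *)

(** The entry at position i of a subsequence sits at position i or later in w. *)
Lemma subseq_sorted_nth (R : realDomainType) (s w : seq R) (i : nat) :
  sorted <=%R w -> subseq s w -> (i < size s)%N -> nth 0 w i <= nth 0 s i.
Proof.
move=> w_sorted; elim: w s i w_sorted => [|z w IHw] [|y s] i //= zw.
have w_sorted := path_sorted zw.
case: eqP => [-> sw|_ sw]; first by case: i => //= i; exact: IHw.
move=> i_s; have isz : (i < size w)%N by apply: leq_trans i_s (size_subseq sw).
apply: le_trans (IHw _ _ w_sorted sw i_s).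
case: i {i_s} isz => [|i] isz /=.
  by case: w zw isz {IHw w_sorted sw} => //= ? ? /andP[].
by apply: (sorted_leq_nth le_trans le_refl 0 w_sorted) => //; rewrite inE // ltnW.
Qed.

Lemma subseq_sorted_sum (R : realDomainType) (s w : seq R) :
  sorted <=%R w -> all (>= 0) w -> subseq s w -> (1 < size s)%N ->
  nth 0 w 0 + nth 0 w 1 <= \sum_(z <- s) z.
Proof.
move=> w_sorted w_ge0 sw s2.
have := subseq_sorted_nth (i := 1) w_sorted sw s2.
have := subseq_sorted_nth (i := 0) w_sorted sw (ltnW s2).
have s_ge0 : all (>= 0) s.
  by apply/allP => z /(mem_subseq sw) /(allP w_ge0).
case: s s2 s_ge0 {sw} => [|y1 [|y2 s]] //= _ /and3P[_ _ s_ge0] h0 h1.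
rewrite !big_cons addrA -[leLHS]addr0; apply: lerD; first exact: lerD.
by rewrite big_seq sumr_ge0 // => z /(allP s_ge0).
Qed.

Lemma ler_sum_const_nat (R : numDomainType) (F : nat -> R) (c : R) (a b : nat) :
  (forall i, (a <= i < b)%N -> c <= F i) ->
  (b - a)%:R * c <= \sum_(a <= i < b) F i.
Proof.
by move=> cF; rewrite mulr_natl -sumr_const_nat; exact: ler_sum_nat.
Qed.

(** * Covering [q, 1 - q] by translates of T by single large terms *)

Section Overflow.
Variables (R : realFieldType) (q : R) (w : seq R) (T : R -> Prop).
Hypotheses (q_gt0 : 0 < q) (q_lt : q < 1 / 2).
Let b : R := q - q ^+ 2.
Hypotheses (w_sorted : sorted <=%R w) (b_w : b \in w) (w_ge : all (>= b) w)
  (w_sum : \sum_(z <- w) z = 1 - q ^+ 2).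
Hypothesis w_dich : forall z, z \in w -> b < z -> q - q ^+ 3 <= z.
Hypothesis w_small : exists2 z, z \in w & b < z < q.
Hypothesis T_bounds : forall t, T t -> 0 <= t <= q ^+ 2.
Hypothesis T_hole : forall e, 0 < e ->
  exists2 d, 0 < d < e & ~ T (q ^+ 2 - q ^+ 3 + d).
Local Notation m := (size w).
Local Notation p := (nth 0 w 0 + nth 0 w 1).
Hypothesis cover : forall y, q <= y <= 1 - q -> y < p ->
  exists2 z, z \in w & T (y - z).

(* The multiplicity of b in w. *)
Let r := find (fun z => b < z) w.

Lemma w_le (i j : nat) : (i <= j)%N -> (j < m)%N -> nth 0 w i <= nth 0 w j.
Proof.
move=> ij jm; apply: (sorted_leq_nth le_trans le_refl 0 w_sorted) => //.
by rewrite inE (leq_ltn_trans ij).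
Qed.

Lemma w_geb (i : nat) : (i < m)%N -> b <= nth 0 w i.
Proof. by move=> im; apply: (allP w_ge); exact: mem_nth. Qed.

Lemma r_lt : (r < m)%N.
Proof. by rewrite -has_find; apply/hasP; have [z zw /andP[bz _]] := w_small;
  exists z. Qed.

Lemma w_before (i : nat) : (i < r)%N -> nth 0 w i = b.
Proof.
move=> ir; apply/eqP; rewrite eq_le w_geb ?(ltn_trans ir r_lt) // andbT.
by rewrite leNgt (before_find 0 ir).
Qed.

Lemma w_after (i : nat) : (r <= i < m)%N -> q - q ^+ 3 <= nth 0 w i.
Proof.
move=> /andP[ri im]; apply: w_dich; first exact: mem_nth.
by apply: lt_le_trans (w_le ri im); apply: (nth_find 0); rewrite has_find r_lt.
Qed.

Lemma w_r_lt : nth 0 w r < q.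
Proof.
have [z zw /andP[bz zq]] := w_small; apply: le_lt_trans zq.
rewrite -(nth_index 0 zw); apply: w_le; last by rewrite index_mem.
rewrite leqNgt; apply/negP => /w_before; rewrite nth_index // => zb.
by rewrite zb ltxx in bz.
Qed.

Lemma r_gt0 : (0 < r)%N.
Proof.
rewrite lt0n; apply/eqP => r0.
have : b < nth 0 w 0 by rewrite -r0; apply: (nth_find 0); rewrite has_find r_lt.
have := @w_le 0 (index b w) isT; rewrite index_mem nth_index // => /(_ b_w).
by rewrite leNgt => /negPf ->.
Qed.

Lemma w_sumE : r%:R * b + \sum_(r <= i < m) nth 0 w i = 1 - q ^+ 2.
Proof.
rewrite -w_sum [RHS](big_nth 0) (big_cat_nat (leq0n r) (ltnW r_lt)) /=.
congr (_ + _); rewrite big_nat (eq_bigr (fun=> b)) => [|i ir]; last exact: w_before.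
by rewrite -big_nat sumr_const_nat subn0 mulr_natl.
Qed.

Lemma b_gt0 : 0 < b.
Proof. by rewrite /b; have [q0 q2] := (q_gt0, q_lt); nra. Qed.

(** With only two terms, the one above b would be 1 - q, which exceeds q. *)
Lemma m_ge3 : (2 < m)%N.
Proof.
have [q0 q2] := (q_gt0, q_lt).
have [[[r0 rm] zq] ws] := (r_gt0, r_lt, w_r_lt, w_sumE).
rewrite ltnNge; apply/negP => m2.
have [r1 m2'] : r = 1%N /\ m = 2%N by lia.
move: ws zq; rewrite r1 m2' big_nat1 /b; lra.
Qed.

(** A third term, of size at least q - q^2, remains besides the two smallest. Hence [cover] is
    available on all of [q, p[. *)
Lemma p_le : p <= 1 - q.
Proof.
have m3 := m_ge3; have b0 := b_gt0; have w2 := w_geb m3.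
have : \sum_(3 <= i < m) nth 0 w i >= (m - 3)%:R * 0.
  by apply: ler_sum_const_nat => i /andP[_ im]; apply: le_trans (w_geb im);
    exact: ltW.
rewrite mulr0 => ge0.
have [m0 m1] : (0 < m)%N /\ (1 < m)%N by lia.
have := w_sum; rewrite (big_nth 0) (big_ltn m0) (big_ltn m1) (big_ltn m3).
move: w2; rewrite /b; lra.
Qed.

(* Single terms alone have to cover [q, p[, since any two of them sum up to
   at least p. *)
Lemma w_step (i : nat) : (i < m)%N -> q < Num.min (nth p w i.+1) p ->
  Num.min (nth p w i.+1) p - q ^+ 2 <= nth 0 w i.
Proof.
(* The default [p] stands in for a term after the last one. Points strictly between l and M lie
   beyond the reach of the terms up to index i and before all later terms. *)
set M := Num.min _ _ => im qM; rewrite leNgt; apply/negP => wM.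
pose l := Num.max q (nth 0 w i + q ^+ 2).
have lM : l < M by rewrite gt_max qM /=; lra.
have Mp : M <= p by rewrite ge_min lexx orbT.
have [ql wl] : q <= l /\ nth 0 w i + q ^+ 2 <= l by rewrite !le_max !lexx orbT.
have p1 := p_le.
have [||z zw /T_bounds/andP[z1 z2]] := @cover ((l + M) / 2); [by apply/andP;
  split; lra|by lra|].
have [iz|zi] := leqP (index z w) i.
  have := w_le iz im; rewrite nth_index //; lra.
have zm : (index z w < m)%N by rewrite index_mem.
have := w_le zi zm; rewrite nth_index // (set_nth_default p) ?(leq_ltn_trans zi) // => h.
have : M <= z by rewrite ge_min h.
by lra.
Qed.

(** Going down from the largest term, each index costs at most q^2, since T lies in [0, q^2]; this
    continues while the bound exceeds q. *)
Lemma w_descent (j : nat) : (j < m)%N -> q < p - j%:R * q ^+ 2 ->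
  p - j.+1%:R * q ^+ 2 <= nth 0 w (m - j.+1).
Proof.
have q2 : 0 < q ^+ 2 by rewrite exprn_gt0.
elim: j => [|j IHj] jm.
  rewrite mul0r subr0 mul1r => qp.
  have := @w_step (m - 1); rewrite subn1 prednK // nth_default // minxx.
  by apply; rewrite ?ltn_predL // ltnW.
move=> qp; have jE : j.+2%:R = j.+1%:R + 1 :> R by rewrite natr1.
have {}IHj : p - j.+1%:R * q ^+ 2 <= nth 0 w (m - j.+1).
  by apply: IHj; [exact: ltnW|move: qp; rewrite -natr1; lra].
have := @w_step (m - j.+2).
have -> : (m - j.+2).+1 = (m - j.+1)%N by lia.
have mj : (m - j.+1 < m)%N by lia.
have M_ge : p - j.+1%:R * q ^+ 2 <= Num.min (nth p w (m - j.+1)) p.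
  rewrite le_min (set_nth_default 0) // IHj /=.
  have : 0 <= j.+1%:R * q ^+ 2 by rewrite mulr_ge0 // ltW.
  by lra.
have qM := lt_le_trans qp M_ge.
move=> /(_ (leq_subr _ _) qM); rewrite jE; lra.
Qed.

(** The descent forces many terms, and then their sum forces q^2 - 3q + 1 <= 0. But b and two terms
    of size at least q - q^3 already give 3q - 2q^3 <= 1, and together these yield q^2 (1 - 2q) <=
    0. *)
Lemma overflow_simple : r = 1%N -> False.
Proof.
move=> r1; have [q0 q2] := (q_gt0, q_lt).
have m3 := m_ge3; have [n mE] : exists n, m = n.+3 by exists (m - 3)%N; lia.
have w0 : nth 0 w 0 = b by rewrite w_before // r1.
have w1q : nth 0 w 1 < q by rewrite -{1}r1 w_r_lt.
have w1 : q - q ^+ 3 <= nth 0 w 1 by apply: w_after; rewrite r1 mE.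
have := w_sumE; rewrite r1 mul1r mE big_nat_recr //=.
have : n.+1%:R * (q - q ^+ 3) <= \sum_(1 <= i < n.+2) nth 0 w i.
  rewrite -[n.+1]subn0 -subSS; apply: ler_sum_const_nat => i /andP[i1 i2].
  by apply: w_after; rewrite r1 mE i1 ltnW.
set S := \sum_(_ <= _ < _) _ => S_ge sumE.
have q3 : q ^+ 3 = q * q ^+ 2 by rewrite exprS.
have last1 : q - q ^+ 3 <= nth 0 w n.+2 by apply: w_after; rewrite r1 mE /=.
have bq : b = q - q ^+ 2 by [].
have last2 : p - q ^+ 2 <= nth 0 w n.+2.
  have := @w_descent 0; rewrite mE subn1 mul0r subr0 mul1r; apply => //.
  rewrite w0; nra.
have kE : n.+2%:R = n.+1%:R + 1 :> R by rewrite natr1.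
(* Otherwise the descent reaches index 1 and bounds w_1 below by w_1 + b - (n + 2) q^2, which
   exceeds w_1. *)
have long : 1 - q <= n.+2%:R * q.
  rewrite leNgt; apply/negP => short.
  have := @w_descent n.+1; rewrite mE subSn // subnn.
  have nq : n.+2%:R * q ^+ 2 < (1 - q) * q by rewrite expr2 mulrA ltr_pM2r.
  rewrite w0; move=> /(_ (leqnSn _)) descent.
  have : b + nth 0 w 1 - n.+2%:R * q ^+ 2 <= nth 0 w 1.
    by apply: descent; move: nq w1; rewrite kE bq q3; nra.
  by move: nq; rewrite bq; nra.
have n1 : 1 <= n.+1%:R :> R by rewrite ler1n.
move: long S_ge; rewrite kE; set k := n.+1%:R in n1 * => long S_ge.
have sq0 : 0 < q - q ^+ 3 by nra.
have qq0 : 0 < q ^+ 2 * (1 - 2 * q) by apply: mulr_gt0; [rewrite exprn_gt0|lra].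
have kq : (1 - q) * (1 - q ^+ 2) <= (k + 1) * q * (1 - q ^+ 2).
  by rewrite ler_wpM2r // subr_ge0 exprn_ile1 ?ltW //; lra.
(* The sum counts b, the n + 1 middle terms, and a last term of at least b + w_1 - q^2. *)
have c1 : q * (q ^+ 2 - 3 * q + 1) <= 0.
  by move: last2 sumE S_ge kq w1; rewrite w0 bq; lra.
have {}c1 : q ^+ 2 - 3 * q + 1 <= 0 by rewrite -(pmulr_rle0 _ q0).
have k1 : q - q ^+ 3 <= k * (q - q ^+ 3) by rewrite ler_peMl // ltW.
move: sumE S_ge k1 last1 c1 qq0; rewrite bq; lra.
Qed.

(** * The case where b occurs at least twice *)

Section Multiple.
Hypothesis r_ge2 : (1 < r)%N.
Local Notation N := (m - r)%N.

Lemma p_eq : p = 2 * b.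
Proof. by rewrite !w_before ?(ltnW r_ge2) // mulr_natl. Qed.

(** Once the descent stops, at 2b - j q^2 <= q, its next bound is at most q - q^2 = b and holds
    trivially. *)
Lemma w_from_top (j : nat) : (j < m)%N ->
  2 * b - j.+1%:R * q ^+ 2 <= nth 0 w (m - j.+1).
Proof.
move=> jm; have [qj|jq] := ltP q (2 * b - j%:R * q ^+ 2).
  by rewrite -p_eq; apply: w_descent; rewrite // p_eq.
apply: le_trans (w_geb _); last by lia.
have bq : b = q - q ^+ 2 by [].
by rewrite -natr1; lra.
Qed.

Lemma sum_from_top (k : nat) : (k <= m)%N ->
  k%:R * (2 * b) - k%:R * (k%:R + 1) / 2 * q ^+ 2 <=
    \sum_(m - k <= i < m) nth 0 w i.
Proof.
elim: k => [_|k IHk km]; first by rewrite subn0 big_geq //; lra.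
rewrite big_ltn; last by lia.
have -> : (m - k.+1).+1 = (m - k)%N by lia.
have := IHk (ltnW km); have := w_from_top km.
have -> : k.+1%:R = k%:R + 1 :> R by rewrite natr1.
by lra.
Qed.

Lemma r_natr_ge2 : 2 <= r%:R :> R.
Proof. by rewrite ler_nat. Qed.

(** Here N counts the terms above b. After N steps down from p = 2b the bound applies to the
    smallest of them, which is less than q. *)
Lemma N_natr_gt : 1 - 2 * q < N%:R * q.
Proof.
have [q0 q2] := (q_gt0, q_lt); rewrite ltNge; apply/negP => short.
have [k Nk] : exists k, N = k.+1 by exists N.-1; have := r_lt; lia.
have := @w_from_top k; rewrite -Nk subKn ?(ltnW r_lt) // => h.
have {}h : 2 * b - N%:R * q ^+ 2 <= nth 0 w r by apply: h; have := r_lt; lia.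
have := w_r_lt; have : N%:R * q ^+ 2 <= (1 - 2 * q) * q by rewrite expr2 mulrA ler_pM2r.
have bq : b = q - q ^+ 2 by [].
by move: h; rewrite bq; nra.
Qed.

Lemma r_b_ge : 2 * b <= r%:R * b.
Proof. by rewrite ler_pM2r ?b_gt0 // r_natr_ge2. Qed.

Lemma after_ge (c : R) : (forall i, (r <= i < m)%N -> c <= nth 0 w i) ->
  2 * b + N%:R * c <= 1 - q ^+ 2.
Proof.
move=> cw; have := w_sumE; have := r_b_ge; have := ler_sum_const_nat cw; lra.
Qed.

(* The lower bound [sum_from_top] on the sum is concave in v := N q, and for
   q <= 1/4 it is too large at both ends of the range 1 - 2 q < v <= 1 - q. *)
Lemma multiple_q_gt : 1 / 4 < q.
Proof.
have [q0 q2] := (q_gt0, q_lt); rewrite ltNge; apply/negP => q4.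
have := @after_ge b; have := sum_from_top (leq_subr r m).
rewrite subKn ?(ltnW r_lt) // => top few.
have {}few : 2 * b + N%:R * b <= 1 - q ^+ 2.
  by apply: few => i /andP[_]; exact: w_geb.
have := N_natr_gt; have := w_sumE; have := r_b_ge.
have bq : b = q - q ^+ 2 by [].
set n := N%:R in top few *; set S := \sum_(_ <= _ < _) _ in top * => rb sumE nq.
have {rb sumE}top : 2 * b + (n * (2 * b) - n * (n + 1) / 2 * q ^+ 2) <= 1 - q ^+ 2.
  by lra.
set v := n * q in nq.
have {few}few : v <= 1 - q.
  have : v * (1 - q) <= (1 - q) * (1 - q) by move: few; rewrite /v bq; nra.
  by rewrite ler_pM2r //; lra.
have {top}top : 2 * (1 - q) * v - v * (v + q) / 2 <= (1 - q) * (1 - q).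
  by move: top; rewrite /v bq; nra.
(* With f(v) the left-hand side of [top], this product is f(v) - f(1 - 2q), and f(1 - 2q) = 3/2 (1 -
   q)(1 - 2q) is at least (1 - q)^2 for q <= 1/4. *)
have : 0 < (v - (1 - 2 * q)) * (2 - 5 / 2 * q - (v + 1 - 2 * q) / 2).
  by apply: mulr_gt0; lra.
nra.
Qed.

(** For q > 1/4, two copies of b and three terms of size at least q - q^3 exceed 1 - q^2. *)
Lemma N_le2 : (N <= 2)%N.
Proof.
have [q0 q2] := (q_gt0, q_lt); have q4 := multiple_q_gt.
rewrite leqNgt; apply/negP => N3.
have := after_ge w_after.
have sq0 : 0 < q - q ^+ 3 by nra.
have : 3 * (q - q ^+ 3) <= N%:R * (q - q ^+ 3) by rewrite ler_pM2r // ler_nat.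
have bq : b = q - q ^+ 2 by [].
have q3 : q ^+ 3 = q * q ^+ 2 by rewrite exprS.
by rewrite bq; nra.
Qed.

(** The bound [sum_from_top] reduces to (4q - 1)(1 - 2q) <= 0. *)
Lemma N_neq2 : N != 2%N.
Proof.
have [q0 q2] := (q_gt0, q_lt); have q4 := multiple_q_gt.
apply/eqP => N2.
have := sum_from_top (leq_subr r m); rewrite subKn ?(ltnW r_lt) // N2.
have := w_sumE; have := r_b_ge.
have bq : b = q - q ^+ 2 by [].
by rewrite bq; nra.
Qed.

Lemma overflow_multiple : False.
Proof.
have [q0 q2] := (q_gt0, q_lt); have q4 := multiple_q_gt.
have bq : b = q - q ^+ 2 by [].
have q3 : q ^+ 3 = q * q ^+ 2 by rewrite exprS.
have N1 : N = 1%N by have := N_le2; have := N_neq2; have := r_lt; lia.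
(* A single term above b sharpens the bound to q > 1/3, which leaves no room for three copies of
   b. *)
have := N_natr_gt; rewrite N1 mul1r => {}q4.
have mE : m = r.+1 by have := r_lt; lia.
have z_ge : q - q ^+ 3 <= nth 0 w r by apply: w_after; rewrite mE leqnn /=.
have z_lt := w_r_lt.
have := w_sumE; rewrite mE big_nat1 => sumE.
have r2 : r = 2%N.
  apply/eqP; rewrite eqn_leq r_ge2 andbT leqNgt; apply/negP => r3.
  have : 3 * b <= r%:R * b by rewrite ler_pM2r ?b_gt0 // ler_nat.
  by rewrite bq; nra.
move: sumE z_ge z_lt; rewrite r2; set z := nth 0 w 2 => sumE z_ge z_lt.
have zE : z = (1 - q) ^+ 2 by rewrite bq in sumE; lra.
(* The room left below p = 2b equals (1 - q)(q - z). A hole of z + T placed there is out of reach of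
   b + T, which ends at q. *)
have e0 : 0 < 2 * b - (z + q ^+ 2 - q ^+ 3).
  have : 0 < (1 - q) * (q - z) by apply: mulr_gt0; lra.
  by rewrite zE bq; nra.
have [d /andP[d0 d1] Td] := T_hole e0.
have p1 := p_le; rewrite p_eq in p1.
have [||y yw] := @cover (z + (q ^+ 2 - q ^+ 3 + d)).
- by apply/andP; split; nra.
- by rewrite p_eq; lra.
have [i im <-] := nthP 0 yw; rewrite mE r2 in im.
case: i im => [|[|[|//]]] _; last by rewrite addrC addKr.
all: rewrite w_before ?r2 // => /T_bounds/andP[_]; nra.
Qed.

End Multiple.

Lemma overflow : False.
Proof.
have := r_gt0; case: (ltngtP r 1) => // [r2 _|r1 _]; first exact: overflow_multiple.
exact: overflow_simple.
Qed.

End Overflow.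

(** Finiteness of w lets a point just to the right of q be chosen below all terms exceeding q. *)
Lemma margin_above (R : realDomainType) (q e : R) (w : seq R) : 0 < e ->
  exists d, [/\ 0 < d, d <= e & forall z, z \in w -> q < z -> q + d <= z].
Proof.
move=> e0; elim: w => [|y w [d [d0 de dw]]]; first by exists e.
have [yq|qy] := leP y q.
  by exists d; split=> // z; rewrite inE => /predU1P[->|/dw//]; rewrite ltNge yq.
exists (Num.min d (y - q)); split; first by rewrite lt_min d0 subr_gt0.
  by rewrite ge_min de.
move=> z; rewrite inE -lerBrDl ge_min => /predU1P[->|zw]; first by rewrite lexx orbT.
by move=> /(dw z zw); rewrite -lerBrDl => ->.
Qed.

(** * Application to the regular Cantorval *)

Unset Implicit Arguments.

Theorem theorem7 (R : realType) (q : R) (H : set nat)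
  (q_gt0 : 0 < q) (q_lt : q < 1 / 2)
  (H_pos : H `<=` posnat)
  (H_inf : infinite_set H) (Hc_inf : infinite_set (posnat `\` H))
  (H1 : ~ H 1%N) (H2 : H 2%N) :
  ~ (exists x : R^nat,
       absolutely_summable x /\ achievement_set x = regular_cantorval q H).
Proof.
case=> x [x_sum xE].
(* H' records the steps acting inside the intervals of length q^2 left after two steps. *)
pose H' := shift_steps (shift_steps H).
have achE y : achievement_set x y = regular_cantorval q H y by rewrite xE.
have sH_pos := @shift_steps_pos H.
have H'_pos := @shift_steps_pos (shift_steps H).
have H'_inf := shift_steps_infinite (shift_steps_infinite H_inf).
have q20 : 0 < q ^+ 2 by rewrite exprn_gt0.
have q2q : 2 * q ^+ 2 < q by rewrite expr2 mulrA gtr_pMl //; lra.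
have q3E : q ^+ 3 = q ^+ 2 * q by rewrite exprSr.
have tailE t : 0 <= t <= 1 -> regular_cantorval q H (q ^+ 2 * t) <->
  regular_cantorval q H' t.
  move=> t01; rewrite expr2 -mulrA cantorval_left //; first exact: cantorval_left.
  have /andP[t0 t1] := scale_bounds q_gt0 t01; rewrite t0 /=; lra.
have tail_rightE t : 0 <= t <= 1 ->
  regular_cantorval q H (q - q ^+ 2 + q ^+ 2 * t) <-> regular_cantorval q H' t.
  move=> t01; have -> : q - q ^+ 2 + q ^+ 2 * t = q * (1 - q + q * t) by ring.
  rewrite cantorval_left //; first exact: cantorval_right.
  have /andP[t0 t1] := scale_bounds q_gt0 t01.
  by apply/andP; split; lra.
(* Since 2 lies in H, step 2 removes the middle of [0, q]. *)
have first_gap t : regular_cantorval q H t -> ~ (q ^+ 2 < t < q - q ^+ 2).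
  move=> + /andP[t1 t2].
  have -> : t = q * (t / q) by field; rewrite gt_eqF.
  rewrite cantorval_left //; last first.
    rewrite divr_ge0 ?(ltW q_gt0) ?ler_pdivrMr ?mul1r //=; lra.
  move=> /cantorval_mid -/(_ q_gt0 q_lt sH_pos) []; last by split.
  rewrite ltr_pdivlMr // ltr_pdivrMr // -expr2 t1 /=; lra.
(* A missed window would rescale to a gap of length (1 - 2q)/q in the Cantorval of H', longer than 1
   - 2q. *)
have dense_below u : 0 <= u -> u + (q - q ^+ 2 - q ^+ 2) <= q ^+ 2 ->
    exists2 t, achievement_set x t & u < t < u + (q - q ^+ 2 - q ^+ 2).
  move=> u0 u1; apply: contrapT => none.
  have : (u + (q - q ^+ 2 - q ^+ 2)) / q ^+ 2 - u / q ^+ 2 <= 1 - 2 * q.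
    apply: (gap_length q_gt0 q_lt H'_pos H'_inf).
    - by rewrite divr_ge0 // ltW.
    - by rewrite ler_pdivrMr // mul1r.
    move=> s /andP[]; rewrite ltr_pdivrMr // ltr_pdivlMr // => s1 s2 Ns.
    apply: none; exists (q ^+ 2 * s); last by rewrite mulrC s1 s2.
    rewrite achE; apply/tailE => //; apply/andP; split.
      by rewrite -(ler_pM2r q20); lra.
    by rewrite -(ler_pM2r q20); lra.
  rewrite -mulrBl ler_pdivrMr // => le1.
  have : 0 < (1 - 2 * q) * (1 - q) * q by rewrite !mulr_gt0 //; lra.
  lra.
have x_ge0 n : 0 <= x n.
  have : regular_cantorval q H (x n) by rewrite -achE; exists (pred1 n);
    exact: achievement_term.
  by move=> /cantorval_bounds/andP[].
have a_ach : achievement_set x (q ^+ 2).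
  rewrite achE -[q ^+ 2]mulr1; apply/tailE; first by rewrite ler01 lexx.
  exact: cantorval1.
have c_ach : achievement_set x (q - q ^+ 2).
  rewrite achE -[q - q ^+ 2]addr0 -[X in _ + X](mulr0 (q ^+ 2)).
  by apply/tail_rightE; [rewrite ler01 lexx|exact: cantorval0].
have ac : q ^+ 2 < q - q ^+ 2 by lra.
have [|w [w_sorted b_w w_ge w_sum [w_add w_dec]]] :=
    gap_decomposition x_ge0 x_sum ac (ltW q20) _ dense_below a_ach c_ach.
  by move=> t; rewrite achE; exact: first_gap.
have total : subsum x predT = 1.
  apply/eqP; rewrite eq_le; apply/andP; split.
    have : regular_cantorval q H (subsum x predT) by rewrite -achE;
      exact: subsum_ach.
    by move=> /cantorval_bounds/andP[].
  have : achievement_set x 1 by rewrite achE; exact: cantorval1.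
  by move=> /achievement_setP-/(_ x_ge0 x_sum)[e ->]; exact: le_subsum.
have {}w_sum : \sum_(z <- w) z = 1 - q ^+ 2 by rewrite -total -w_sum addrK.
pose T t := regular_cantorval q H t /\ t <= q ^+ 2.
have T_bounds t : T t -> 0 <= t <= q ^+ 2.
  by case=> /cantorval_bounds/andP[-> _] ->.
have T_scale t : 0 <= t -> ~ regular_cantorval q H' t -> ~ T (q ^+ 2 * t).
  move=> t0 H't [Ht]; rewrite -[leRHS]mulr1 ler_pM2l // => t1.
  by apply: H't; apply/tailE => //; rewrite t0 t1.
have mid_in y : q <= y <= 1 - q -> regular_cantorval q H y.
  rewrite le_eqVlt => /andP[/predU1P[<- _|qy]]; first exact: cantorval_q.
  rewrite le_eqVlt => /predU1P[->|yq]; first exact: cantorval_1Bq.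
  by apply/cantorval_mid => //; rewrite qy yq.
have w_ge0 : all (>= 0) w.
  by apply/allP => z /(allP w_ge) /=; lra.
(* Two or more terms sum up to at least the two smallest, and no term at all leaves at most q^2 < q.
   The guarded bound allows a use before w is known to have two terms. *)
have cover y : q <= y <= 1 - q ->
    ((1 < size w)%N -> y < nth 0 w 0 + nth 0 w 1) ->
    exists2 z, z \in w & T (y - z).
  move=> yq yp; have Ny := mid_in y yq; rewrite -achE in Ny.
  have [s sw [t]] := w_dec y Ny; rewrite achE => Nt [ta yE].
  have s1 : (size s <= 1)%N.
    rewrite leqNgt; apply/negP => s2.
    have := yp (leq_trans s2 (size_subseq sw)).
    have := subseq_sorted_sum w_sorted w_ge0 sw s2.
    have /andP[+ _] := cantorval_bounds Nt; rewrite yE; lra.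
  case: s s1 sw yE => [|z [|//]] _ sw yE.
    by move: yE yq; rewrite big_nil => -> /andP[]; lra.
  exists z; first by apply: (mem_subseq sw); rewrite inE.
  by rewrite yE big_seq1 addrC addKr; split.
apply: (overflow q_gt0 q_lt w_sorted b_w w_ge w_sum _ _ T_bounds).
- move=> z zw bz; have [qz|zq] := leP q z; first by have := exprn_gt0 3 q_gt0; lra.
  (* Adding z to T stays in N_q^H; seen from b at scale q^2, this shifts the Cantorval of H' by (z -
     b)/q^2. *)
  have : 1 - q <= (z - (q - q ^+ 2)) / q ^+ 2; last first.
    by rewrite ler_pdivlMr // q3E; lra.
  apply: (translation_large q_gt0 q_lt H'_pos H'_inf).
    by rewrite divr_gt0 ?subr_gt0 //= ltr_pdivrMr // mul1r; lra.
  move=> v Nv vt; have /andP[v0 v1] := cantorval_bounds Nv.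
  apply/tail_rightE.
    rewrite vt andbT addr_ge0 // divr_ge0 ?(ltW q20) // subr_ge0 ltW //.
  have -> : q - q ^+ 2 + q ^+ 2 * (v + (z - (q - q ^+ 2)) / q ^+ 2) = z + q ^+ 2 * v.
    by field; rewrite gt_eqF.
  rewrite -achE; apply: w_add => //.
    by rewrite achE; apply/tailE => //; rewrite v0 v1.
  by rewrite ger_pMr.
(* The bound e keeps q + q^2 d below 1 - q, below any sum of two terms of w and below all terms
   exceeding q. As q^2 d is not in T, the term q cannot cover this point, so a smaller term above b
   does. *)
- have e0 : 0 < Num.min (1 - 2 * q) (q - 2 * q ^+ 2) by rewrite lt_min;
  apply/andP; split; lra.
  have [e [{}e0 + ew]] := margin_above q w e0.
  rewrite le_min => /andP[e1 e2].
  have eq0 : 0 < e / q ^+ 2 by rewrite divr_gt0.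
  have [d /andP[d0]] := cantorval_hole_near q_gt0 q_lt H'_pos H'_inf eq0.
  rewrite ltr_pdivlMr // => de [d1 /(T_scale _ (ltW d0)) Td _].
  have qd : 0 < q ^+ 2 * d by rewrite mulr_gt0.
  have [||z zw Tz] := cover (q + q ^+ 2 * d).
  + by apply/andP; split; lra.
  + move=> w2; have w0 := allP w_ge _ (mem_nth 0 (ltnW w2)).
    by have w1 := allP w_ge _ (mem_nth 0 w2); rewrite /= in w0 w1; lra.
  have /andP[z0 z1] := T_bounds _ Tz.
  have zq : z <= q by rewrite leNgt; apply/negP => /(ew z zw); lra.
  exists z => //; apply/andP; split; first by lra.
  rewrite lt_neqAle zq andbT; apply/negP => /eqP zE.
  by apply: Td; move: Tz; rewrite zE addrC addKr.
(* The hole comes from one of the Cantorval of H' just to the right of 1 - q, scaled by q^2. *)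
- move=> e e0; have eq0 : 1 - q < 1 - q + e / q ^+ 2 by rewrite ltrDl divr_gt0.
  have [s /andP[s1]] := hole_right_1Bq q_gt0 q_lt H'_pos H'_inf eq0.
  rewrite -ltrBlDl ltr_pdivlMr // => s2 /(T_scale _ _) Ts.
  exists (q ^+ 2 * s - (q ^+ 2 - q ^+ 3)).
    have : (1 - q) * q ^+ 2 < s * q ^+ 2 by rewrite ltr_pM2r.
    by move=> h; apply/andP; split; rewrite q3E; lra.
  by rewrite addrC subrK; apply: Ts; lra.
- by move=> y yq yp; apply: cover.
Qed.
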